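(* The implication ''if $A\subseteq X$ is compact in $(X,\tau)$ then $A$ is $\mathfrak{a}$-compact'' cannot be reversed in general: there exist an $\mathfrak{a}$-space $(X,\tau,\mathfrak{a})$ and a subset $A\subseteq X$ such that $A$ is $\mathfrak{a}$-compact but $A$ is not compact in $(X,\tau)$.
   Context: An aura topological space (or $\mathfrak{a}$-space) $(X,\tau,\mathfrak{a})$ is a topological space $(X,\tau)$ together with a function $\mathfrak{a}:X\to\tau$ (a scope function) such that $x\in\mathfrak{a}(x)$ for every $x\in X$. A subset $A\subseteq X$ is $\mathfrak{a}$-open if $\mathfrak{a}(x)\subseteq A$ for every $x\in A$; the collection $\tau_{\mathfrak{a}}$ of all $\mathfrak{a}$-open sets is a topology on $X$ with $\tau_{\mathfrak{a}}\subseteq\tau$. A subset $A\subseteq X$ is $\mathfrak{a}$-compact if every cover of $A$ by members of $\tau_{\mathfrak{a}}$ has a finite subcover. *)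

(* Defs.v *)
From mathcomp Require Import all_boot all_order.
From mathcomp Require Import all_classical.
From mathcomp Require Import topology.

Set Implicit Arguments.
Unset Strict Implicit.
Unset Printing Implicit Defensive.

Local Open Scope classical_set_scope.

(* The codomain tau of the scope function is rendered by [scope_open]. *)
Record auraSpace := AuraSpace {
  aura_carrier :> topologicalType;
  scope : aura_carrier -> set aura_carrier;
  scope_open : forall x, open (scope x);
  scope_mem : forall x, scope x x
}.

Definition aura_open (X : auraSpace) (A : set X) : Prop :=
  forall x, A x -> scope x `<=` A.

Definition aura_topology (X : auraSpace) : set (set X) :=
  [set A | aura_open A].

Lemma aura_topologyT (X : auraSpace) : @aura_topology X setT.
Proof. by []. Qed.

Lemma aura_topologyI (X : auraSpace) (A B : set X) :
  aura_topology A -> aura_topology B -> aura_topology (A `&` B).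
Proof. by move=> oA oB x [Ax Bx] y sy; split; [exact: oA sy|exact: oB sy]. Qed.

Lemma aura_topology_bigcup (X : auraSpace) (C : set (set X)) :
  C `<=` @aura_topology X -> aura_topology (\bigcup_(U in C) U).
Proof. by move=> oC x [U CU Ux] y sy; exists U => //; exact: (oC U CU x). Qed.

Lemma aura_topology_open (X : auraSpace) : @aura_topology X `<=` open.
Proof.
move=> A oA; rewrite openE => x Ax.
exact: filterS (oA x Ax) (open_nbhs_nbhs (conj (scope_open x) (scope_mem x))).
Qed.

Definition aura_compact (X : auraSpace) (A : set X) : Prop :=
  forall C : set (set X), C `<=` @aura_topology X ->
    A `<=` \bigcup_(U in C) U ->
  exists D : set (set X),
    [/\ D `<=` C, finite_set D & A `<=` \bigcup_(U in D) U].

(* Main.v *)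
Require Import Defs.
From mathcomp Require Import all_boot all_order.
From mathcomp Require Import all_classical.
From mathcomp Require Import topology.

Local Open Scope classical_set_scope.

(** A constant scope [setT] makes every subset aura-compact, whatever the underlying topology, so
    any non-compact space, here discrete [nat], gives a counterexample. *)

Lemma nat_not_compact : ~ compact [set: nat].
Proof.
(* [\oo] has no cluster point: the tail beyond [n] misses the neighbourhood [[set n]]. *)
move=> /(_ \oo%classic _ filterT)[n [_ /(_ [set m | n < m] [set n])]].
case; [exact: nbhs_infty_gt|by rewrite nbhs_principalE|].
by move=> m [/= + mn]; rewrite mn ltnn.
Qed.

(* With the constant scope [setT] the only aura-open sets are [set0] and
   [setT]. *)
Definition indiscrete_aura (T : topologicalType) : auraSpace :=
  @AuraSpace T (fun=> setT) (fun=> openT) (fun=> I).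

Lemma indiscrete_aura_compact (T : topologicalType)
  (A : set (indiscrete_aura T)) : aura_compact A.
Proof.
move=> C Copen AC; have [->|/set0P[x Ax]] := eqVneq A set0.
  by exists set0; split; [exact: sub0set|exact: finite_set0|exact: sub0set].
(* As [U] contains the point [x], it contains [scope x], the whole space, and covers [A] alone. *)
have [U CU Ux] := AC x Ax; exists [set U]; split.
- by move=> _ ->.
- exact: finite_set1.
- by move=> y _; exists U => //; exact: Copen CU x Ux y I.
Qed.

Theorem theorem3p4 :
  exists (X : auraSpace) (A : set X), aura_compact A /\ ~ compact A.
Proof.
exists (indiscrete_aura nat), setT; split.
  exact: indiscrete_aura_compact.
exact: nat_not_compact.
Qed.
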